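(* Let $G$ be a group and let $S=\{\mathbf{u}_i\}_{i\in I}$, $\mathbf{u}_i=\{u^i_n\}_{n\in\omega}$, be a non-empty family of sequences in $G$. The following statements are equivalent: 1) $S$ is a $T_s$-set of sequences in $G$; 2) $\bigcap_{\mathbf{j}\in\mathcal{J}} SP_{n\in\omega}A_n(\mathbf{j})=\{e_G\}$. If 1)–2) are fulfilled, then the sets $SP_{n\in\omega}A_n(\mathbf{j})$, $\mathbf{j}\in\mathcal{J}$, form an open base at the unit of $\tau_S$.
   Context: $\omega=\{0,1,2,\dots\}$; $e_G$ is the unit of $G$; $\mathbb{S}_n$ is the group of all permutations of $\{0,1,\dots,n-1\}$. A set $S$ of sequences in $G$ is a $T_s$-set of sequences if there is a Hausdorff group topology on $G$ in which all sequences of $S$ converge to $e_G$; then $\tau_S$ denotes the finest Hausdorff group topology on $G$ with this property. $\mathcal{J}$ is the set of all functions $\mathbf{j}:\omega\times I\times G\to\omega$ such that $\mathbf{j}(k,i,g)<\mathbf{j}(k+1,i,g)$ for all $k\in\omega$, $i\in I$, $g\in G$. For $m,n\in\omega$, $i\in I$ and $\mathbf{j}\in\mathcal{J}$ put $$A^i_m=\{e_G,(u^i_m)^{\pm1},(u^i_{m+1})^{\pm1},\dots\},\qquad A_n(\mathbf{j})=\bigcup_{i\in I}\bigcup_{g\in G}g^{-1}A^i_{\mathbf{j}(n,i,g)}g,$$ $$SP_{n\in\omega}A_n(\mathbf{j})=\bigcup_{n\in\omega}\Big(\bigcup_{\sigma\in\mathbb{S}_{n+1}}A_{\sigma(0)}(\mathbf{j})A_{\sigma(1)}(\mathbf{j})\cdots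 A_{\sigma(n)}(\mathbf{j})\Big).$$ *)

(* Defs.v *)
From mathcomp Require Import all_boot all_fingroup all_classical topology.

Set Implicit Arguments.
Unset Strict Implicit.
Unset Printing Implicit Defensive.

Local Open Scope classical_set_scope.
Local Open Scope group_scope.

Section GroupTopologies.
Variable G : groupType.

(* [Topological G] is the type of topologies on the carrier of [G]; packing one
   gives the corresponding topological space. *)
Definition space (t : Topological G) : topologicalType := Topological.Pack t.

Definition group_topology (t : Topological G) : Prop :=
  let mulG (p : space t * space t) : space t := (p.1 : G) * (p.2 : G) in
  let invG (x : space t) : space t := (x : G)^-1 in
  continuous mulG /\ continuous invG.

Definition cvg_to_unit (t : Topological G) (s : nat -> G) : Prop :=
  (s : nat -> space t) @ \oo --> (1 : space t).

Definition admissible (S : set (nat -> G)) (t : Topological G) : Prop :=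
  [/\ group_topology t, hausdorff_space (space t)
    & forall s, S s -> cvg_to_unit t s].

Definition Ts_set (S : set (nat -> G)) : Prop := exists t, admissible S t.

Definition finer (t t' : Topological G) : Prop :=
  @open (space t') `<=` @open (space t).

(* [t] is the topology tau_S; two such [t] have the same open sets. *)
Definition is_tau (S : set (nat -> G)) (t : Topological G) : Prop :=
  admissible S t /\ forall t', admissible S t' -> finer t t'.

Definition open_base_at_unit (t : Topological G) (B : set (set G)) : Prop :=
  (forall U, B U -> open_nbhs (1 : space t) U) /\
  (forall V, nbhs (1 : space t) V -> exists2 U, B U & U `<=` V).

End GroupTopologies.

Section SP.
Variable G : groupType.

Definition mulset (A B : set G) : set G := [set x * y | x in A & y in B].

Definition conjset (A : set G) (g : G) : set G := [set g^-1 * x * g | x in A].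

Definition SP (A : nat -> set G) : set G :=
  \bigcup_n \bigcup_(s in [set: 'S_n.+1])
    \big[mulset/[set 1]]_(k < n.+1) A (s k).

Variables (I : Type) (u : I -> nat -> G).

Definition J : set (nat -> I -> G -> nat) :=
  [set j | forall k i g, (j k i g < j k.+1 i g)%N].

Definition Aim (i : I) (m : nat) : set G :=
  [set x | x = 1 \/ exists2 n, (m <= n)%N & x = u i n \/ x = (u i n)^-1].

Definition An (j : nat -> I -> G -> nat) (n : nat) : set G :=
  \bigcup_i \bigcup_g conjset (Aim i (j n i g)) g.

End SP.

(* Main.v *)
(* Since each [An u j k] contains the unit and decreases in [k], a point of
   [SP (An u j)] is a product of factors taken from [An u j k] for pairwise
   distinct indices [k], in any order. Thinning or shifting the indices then shows
   that these sets satisfy the axioms of a base of open neighbourhoods of the unit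
   for a group topology in which every [u i] converges to the unit, and which is
   Hausdorff iff the intersection is trivial.
   Conversely, let [V] be a neighbourhood of the unit in a group topology making
   all [u i] converge, and let [W 0 = V] with [W n.+1] cubed contained in [W n]. A
   product with distinct indices of factors in the sets [W k.+1] stays in [V]:
   split it at its least index and induct. As [u i] converges to the unit, so do
   its conjugates, hence some [j] has [An u j k] contained in [W k.+1] for all
   [k], and [SP (An u j)] lies in [V]. *)
From HB Require Import structures.
Require Import Defs.
From mathcomp Require Import all_boot all_fingroup all_classical topology.

Local Open Scope classical_set_scope.
Local Open Scope group_scope.

(** * Products of subsets over lists of indices *)

Section SetProducts.
Context {G : groupType}.
Implicit Types (A : nat -> set G) (r : seq nat) (x y g : G).

Lemma mulsetA : associative (@mulset G).
Proof.
move=> X Y Z; apply/seteqP; split=> [_ [x Xx [_ [y Yy [z Zz <-]] <-]]|].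
  by exists (x * y); [exists x => //; exists y|exists z; rewrite ?mulgA].
move=> _ [_ [x Xx [y Yy <-]] [z Zz <-]]; exists x => //.
by exists (y * z); [exists y => //; exists z|rewrite mulgA].
Qed.

Lemma mul1set : left_id [set 1] (@mulset G).
Proof.
move=> X; apply/seteqP; split=> [_ [_ -> [x Xx <-]]|x Xx]; first by rewrite mul1g.
by exists 1 => //; exists x; rewrite ?mul1g.
Qed.

Lemma mulset1 : right_id [set 1] (@mulset G).
Proof.
move=> X; apply/seteqP; split=> [_ [x Xx [_ -> <-]]|x Xx]; first by rewrite mulg1.
by exists x => //; exists 1; rewrite ?mulg1.
Qed.

HB.instance Definition _ :=
  Monoid.isLaw.Build (set G) [set 1] (@mulset G) mulsetA mul1set mulset1.

Definition prods A r : set G := \big[@mulset G/[set 1]]_(k <- r) A k.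

Lemma prods_cons A k r : prods A (k :: r) = mulset (A k) (prods A r).
Proof. exact: big_cons. Qed.

Lemma prods_cat A r r' : prods A (r ++ r') = mulset (prods A r) (prods A r').
Proof. exact: big_cat. Qed.

Lemma prods_map A (f : nat -> nat) r : prods (A \o f) r = prods A (map f r).
Proof. by rewrite /prods big_map. Qed.

Lemma prods_one {A} r : (forall k, A k 1) -> prods A r 1.
Proof.
move=> A1; elim: r => [|k r IH]; first by rewrite /prods big_nil.
by rewrite prods_cons; exists 1 => //; exists 1; rewrite ?mulg1.
Qed.

Lemma prods_sub {A A'} r : (forall k, A k `<=` A' k) -> prods A r `<=` prods A' r.
Proof.
move=> sA; elim: r => [|k r IH]; first by rewrite /prods !big_nil.
by rewrite !prods_cons => _ [a /sA ? [b /IH ? <-]]; exists a => //; exists b.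
Qed.

Lemma prods_inv {A} r x : (forall k a, A k a -> A k a^-1) ->
  prods A r x -> prods A (rev r) x^-1.
Proof.
move=> AV; elim: r x => [|k r IH] x.
  by rewrite /prods big_nil => ->; rewrite invg1.
rewrite prods_cons => -[a /AV Aa [b /IH rb <-]].
rewrite rev_cons -cats1 prods_cat invgM; exists b^-1 => //; exists a^-1 => //.
by rewrite /prods big_seq1.
Qed.

Lemma prods_conj {A A'} g r x : (forall k a, A k a -> A' k (a ^ g)) ->
  prods A r x -> prods A' r (x ^ g).
Proof.
move=> AA'; elim: r x => [|k r IH] x.
  by rewrite /prods !big_nil => ->; rewrite conj1g.
rewrite !prods_cons => -[a /AA' Aa [b /IH rb <-]]; rewrite conjMg.
by exists (a ^ g) => //; exists (b ^ g).
Qed.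

(** Induction on the length [d] of an interval of indices starting at [p]. The index [p] occurs at
    most once, and the factors on either side of it have indices from [p.+1] on, so both partial
    products lie in [V p.+1]. *)
Lemma prods_nested {V : nat -> set G} :
    (forall n, V n 1) ->
    (forall n a b c, V n.+1 a -> V n.+1 b -> V n.+1 c -> V n (a * b * c)) ->
  forall r d p, uniq r -> (forall k, k \in r -> p <= k < p + d)%N ->
    prods (fun n => V n.+1) r `<=` V p.
Proof.
move=> V1 VM r d; elim: d r => [|d IH] r p Ur rP.
  case: r Ur rP => [_ _|k r _ rP]; first by rewrite /prods big_nil => _ ->.
  by have := rP k (mem_head _ _); rewrite addn0 ltnNge andbN.
have [pr|pNr] := boolP (p \in r); last first.
  (* Without a factor of index [p], two unit factors pad the product to a triple one. *)
  move=> x rx; rewrite -[x]mul1g -[1]mul1g; apply: VM => //.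
  apply: IH rx => // k kr; have := rP k kr; rewrite addSnnS => /andP[pk ->].
  by rewrite andbT ltn_neqAle pk andbT; apply: contraNneq pNr => ->.
case/splitPr: r / pr Ur rP => r1 r2.
rewrite uniq_catC cat_cons /= mem_cat negb_or cat_uniq.
case/and4P=> /andP[pN2 pN1] U2 _ U1 rP.
have bnd k : k \in r1 ++ r2 -> (p.+1 <= k < p.+1 + d)%N.
  move=> kr; have /rP: k \in r1 ++ p :: r2.
    by move: kr; rewrite !mem_cat inE => /orP[] ->; rewrite ?orbT.
  rewrite addSnnS => /andP[pk ->]; rewrite andbT ltn_neqAle pk andbT.
  apply: contraTneq kr => <-.
  by rewrite mem_cat negb_or pN1 pN2.
rewrite prods_cat prods_cons => _ [a Va [_ [b Vb [c Vc <-]] <-]].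
rewrite mulgA; apply: VM => //.
  by apply: IH Va => // k kr; apply: bnd; rewrite mem_cat kr.
by apply: IH Vc => // k kr; apply: bnd; rewrite mem_cat kr orbT.
Qed.

(** Duplicate-free lists replace permutations, so that later changes of indices become list
    operations. *)
Lemma SP_prods {A} : (forall k, A k 1) ->
  SP A = \bigcup_(r in [set r | uniq r]) prods A r.
Proof.
move=> A1; apply/seteqP; split=> x.
  move=> [n _ [s _ sx]]; exists [seq s k : nat | k <- index_enum 'I_n.+1].
    rewrite /= map_inj_uniq ?index_enum_uniq // => k l kl.
    by apply: (@perm_inj _ s); apply: val_inj.
  by rewrite /prods big_map.
move=> [r /= Ur rx].
(* Missing indices below a bound are appended, with factors equal to 1. *)
pose n := \max_(k <- r) k.
pose l := r ++ [seq k <- iota 0 n.+1 | k \notin r].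
have Ul : uniq l.
  rewrite cat_uniq Ur filter_uniq ?iota_uniq // andbT.
  by apply/hasPn => k; rewrite mem_filter => /andP[].
have le_n k : k \in r -> (k <= n)%N.
  by move=> kr; rewrite /n (big_rem _ kr) /= leq_maxl.
have ml k : (k \in l) = (k < n.+1)%N.
  rewrite mem_cat mem_filter mem_iota add0n leq0n /= ltnS.
  by case: (boolP (k \in r)) => //= /le_n ->.
have sl : size l = n.+1.
  rewrite -(size_iota 0 n.+1); apply/perm_size/uniq_perm; rewrite ?iota_uniq //.
  by move=> k; rewrite ml mem_iota.
have nthl (k : 'I_n.+1) : (nth 0 l k < n.+1)%N by rewrite -ml mem_nth ?sl.
(* [l] lists the numbers below [n.+1] once each, so sending a position to its entry is a
   permutation. *)
have inj : injective (fun k : 'I_n.+1 => Ordinal (nthl k)).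
  move=> k k' /(congr1 val)/= /eqP; rewrite nth_uniq ?sl // => /eqP ?.
  exact: val_inj.
exists n => //; exists (perm inj) => //.
under eq_bigr do rewrite permE /=.
rewrite -(big_mkord xpredT (fun k => A (nth 0 l k))) -{1}sl.
rewrite -(big_nth _ xpredT) -/(prods A l) prods_cat.
by exists x => //; exists 1; rewrite ?mulg1 //; apply: prods_one.
Qed.

Lemma SP_one {A} : (forall k, A k 1) -> SP A 1.
Proof. by move=> A1; rewrite SP_prods //; exists [::] => //; apply: prods_one. Qed.

Lemma SP_incl {A} k : (forall k, A k 1) -> A k `<=` SP A.
Proof.
by move=> A1 x Ax; rewrite SP_prods //; exists [:: k] => //; rewrite /prods big_seq1.
Qed.

Lemma SP_sub {A A'} : (forall k, A k `<=` A' k) -> SP A `<=` SP A'.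
Proof.
move=> sA x [n _ [s _ sx]]; exists n => //; exists s => //.
move: sx; rewrite -!(big_map (fun k => s k : nat) xpredT).
exact: prods_sub.
Qed.

Lemma SP_inv {A} x : (forall k, A k 1) -> (forall k a, A k a -> A k a^-1) ->
  SP A x -> SP A x^-1.
Proof.
move=> A1 AV; rewrite SP_prods // => -[r Ur rx]; exists (rev r).
  by rewrite /= rev_uniq.
exact: prods_inv.
Qed.

Lemma SP_conj {A A'} g x : (forall k, A k 1) -> (forall k a, A k a -> A' k (a ^ g)) ->
  SP A x -> SP A' (x ^ g).
Proof.
move=> A1 AA'; have A'1 k : A' k 1 by rewrite -(conj1g g); apply: AA'.
rewrite !SP_prods // => -[r Ur rx]; exists r => //; exact: prods_conj rx.
Qed.

(* Factors of [x] get even indices and factors of [y] odd ones. *)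
Lemma SP_mul {A A'} x y : (forall k, A k 1) -> (forall k, A' k 1) ->
    (forall k, A' k `<=` A k.*2) -> (forall k, A' k `<=` A k.*2.+1) ->
  SP A' x -> SP A' y -> SP A (x * y).
Proof.
move=> A1 A'1 sE sO; rewrite !SP_prods // => -[r /= Ur rx] [r' /= Ur' ry].
exists (map double r ++ map (succn \o double) r').
  rewrite /= cat_uniq !map_inj_uniq ?Ur ?Ur' /= ?andbT; last exact: double_inj.
    apply/hasPn => _ /mapP[k _ ->] /=; apply/mapP => -[k' _].
    by move=> /(congr1 odd); rewrite /= !odd_double.
  by move=> k k' [] /double_inj.
rewrite prods_cat -!prods_map.
exists x; first exact: prods_sub rx.
by exists y => //; apply: prods_sub ry.
Qed.

(** The shift [m] exceeds all indices used for [x], so the shifted indices of [y] are new. *)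
Lemma SP_open {A} x : (forall k, A k 1) -> SP A x ->
  exists m, forall y, SP (fun k => A (m + k)%N) y -> SP A (x * y).
Proof.
move=> A1; rewrite !SP_prods // => -[r /= Ur rx].
exists (\max_(k <- r) k).+1 => y; rewrite SP_prods // => -[r' /= Ur' ry].
set m := (\max_(k <- r) k).+1 in ry *.
exists (r ++ map (addn m) r').
  rewrite /= cat_uniq map_inj_uniq ?Ur ?Ur' /= ?andbT; last exact: addnI.
  apply/hasPn => _ /mapP[k _ ->] /=; apply/negP => kr.
  have : (m + k <= \max_(k <- r) k)%N by rewrite (big_rem _ kr) /= leq_maxl.
  by rewrite leqNgt /m addSn ltnS leq_addr.
by rewrite prods_cat -prods_map; exists x => //; exists y.
Qed.

End SetProducts.

(** * Group topologies from a base at the unit *)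

Section UnitBase.
Context {G : groupType}.

(** The field [unit_base_open] makes the members open, not merely neighbourhoods of the unit. *)
Record unit_base (B : set (set G)) : Prop := {
  unit_base_ex : exists U, B U;
  unit_base1 : forall U, B U -> U 1;
  unit_baseI : forall U U', B U -> B U' -> exists2 W, B W & W `<=` U `&` U';
  unit_base_open : forall U x, B U -> U x ->
    exists2 W, B W & forall y, W y -> U (x * y);
  unit_baseM : forall U, B U ->
    exists2 W, B W & forall x y, W x -> W y -> U (x * y);
  unit_baseV : forall U, B U -> exists2 W, B W & forall x, W x -> U x^-1;
  unit_baseJ : forall U g, B U -> exists2 W, B W & forall x, W x -> U (x ^ g)
}.

(** Later facts about the topology built from [B] rest on this description by left translates, not
    on the construction. *)
Definition nbhs_translates (B : set (set G)) (t : Topological G) : Prop :=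
  forall (x : space t) (V : set G),
    nbhs x V <-> exists2 U, B U & forall y, U y -> V ((x : G) * y).

Lemma unit_base_nbhs (B : set (set G)) : unit_base B ->
  exists t : Topological G, nbhs_translates B t.
Proof.
move=> hB; pose op (O : set G) :=
  forall x, O x -> exists2 U, B U & forall y, U y -> O (x * y).
have opT : op setT by have [U BU] := unit_base_ex _ hB; move=> x _; exists U.
have opI : setI_closed op.
  move=> O O' oO oO' x [/oO[U BU UO] /oO'[U' BU' UO']].
  have [W BW sW] := unit_baseI _ hB _ _ BU BU'.
  by exists W => // y /sW[/UO ? /UO' ?].
have opU (I : Type) (f : I -> set G) : (forall i, op (f i)) -> op (\bigcup_i f i).
  move=> of_ x [i _ /of_[U BU Uf]]; exists U => // y /Uf ?; by exists i.
pose T : topologicalType := HB.pack (G : Type) (Choice.class G) (isOpenTopological.Build G opT opI opU).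
exists (Topological.class T) => x V.
rewrite nbhsE /=; split=> [[O [oO Ox] OV]|[U BU UV]].
  by have [U BU UO] := oO _ Ox; exists U => // y /UO/OV.
(* The left translate of [U] by [x] is itself open, by [unit_base_open]. *)
exists [set z | U (x^-1 * z)]; last by move=> z /UV; rewrite mulKVg.
split; last by rewrite /= mulVg; apply: unit_base1 BU.
move=> z /= /(unit_base_open _ hB _ _ BU)[W BW WU].
by exists W => // y /WU; rewrite mulgA.
Qed.

Section NbhsByBase.
Context {B : set (set G)} {t : Topological G}.

Lemma group_topology_unit_base : unit_base B -> nbhs_translates B t ->
  group_topology t.
Proof.
move=> hB ntE; split=> [[x y] V /ntE[U BU UV]|x V /ntE[U BU UV]].
  (* Since [(x * w) * (y * v) = x * y * (w ^ y * v)], the left factor is controlled through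
     conjugation by [y]. *)
  have [U' BU' MU'] := unit_baseM _ hB _ BU.
  have [W BW JW] := unit_baseJ _ hB _ (y : G) BU'.
  exists ([set z | W ((x : G)^-1 * z)], [set z | U' ((y : G)^-1 * z)]).
    by split; apply/ntE; [exists W|exists U'] => // z; rewrite /= mulKg.
  move=> [a b] /= [/JW Wa Ub]; have := UV _ (MU' _ _ Wa Ub).
  by rewrite /conjg !mulgA !mulgK mulgV mul1g.
(* Here [(x * w)^-1 = x^-1 * (w ^ x^-1)^-1]. *)
have [U' BU' VU'] := unit_baseV _ hB _ BU.
have [W BW JW] := unit_baseJ _ hB _ (x : G)^-1 BU'.
apply/ntE; exists W => // y /JW/VU'/UV /=.
by rewrite -conjVg /conjg invgK invgM !mulgA mulVg mul1g.
Qed.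

(** If [q] clusters at [p], a common point [z = p * w = q * w'] of small translates gives
    [p^-1 * q = w * w'^-1], which lies in any prescribed member of [B]. *)
Lemma hausdorff_unit_base : unit_base B -> nbhs_translates B t ->
  \bigcap_(U in B) U = [set 1] -> hausdorff_space (space t).
Proof.
move=> hB ntE B1 p q pq; apply/esym; rewrite -[LHS](mulKVg (p : G)).
suff -> : (p : G)^-1 * q = 1 by rewrite mulg1.
suff : (\bigcap_(U in B) U) ((p : G)^-1 * q) by rewrite B1.
move=> U BU; have [W BW MW] := unit_baseM _ hB _ BU.
have [W' BW' VW'] := unit_baseV _ hB _ BW.
have [||z [/= pz qz]] := pq [set z | W ((p : G)^-1 * z)] [set z | W' ((q : G)^-1 * z)].
- by apply/ntE; exists W => // y; rewrite /= mulKg.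
- by apply/ntE; exists W' => // y; rewrite /= mulKg.
by have := MW _ _ pz (VW' _ qz); rewrite invgM invgK !mulgA mulgK.
Qed.

Lemma open_base_unit_base : unit_base B -> nbhs_translates B t ->
  open_base_at_unit t B.
Proof.
move=> hB ntE; split=> [U BU|V /ntE[U BU UV]].
  split; last exact: unit_base1 BU.
  rewrite openE => x Ux; apply/ntE.
  by have [W BW WU] := unit_base_open _ hB _ (x : G) BU Ux; exists W.
by exists U => // y /UV; rewrite mul1g.
Qed.

End NbhsByBase.
End UnitBase.

(** * Neighbourhoods in a topological group *)

Section TopologicalGroup.
Context {G : groupType} {t : Topological G} (Gt : group_topology t).

Lemma nbhs_split {x y : G} {V : set G} : nbhs (x * y : space t) V ->
  exists U W : set G, [/\ nbhs (x : space t) U, nbhs (y : space t) W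
    & forall a b, U a -> W b -> V (a * b)].
Proof.
move=> xyV; have [[U W] /= [xU yW] UW] := Gt.1 ((x : space t), (y : space t)) V xyV.
by exists U, W; split=> // a b Ua Wb; apply: (UW (a, b)).
Qed.

Lemma nbhs_mull (x y : G) (V : set G) : nbhs (x * y : space t) V ->
  nbhs (y : space t) [set z : G | V (x * z)].
Proof.
move=> /nbhs_split[U [W [xU yW UW]]]; apply: (filterS _ yW) => z /=; apply: UW.
exact: (nbhs_singleton xU).
Qed.

Lemma nbhs_mulr (x y : G) (V : set G) : nbhs (x * y : space t) V ->
  nbhs (x : space t) [set z : G | V (z * y)].
Proof.
move=> /nbhs_split[U [W [xU yW UW]]]; apply: (filterS _ xU) => z /= Uz; apply: UW => //.
exact: (nbhs_singleton yW).
Qed.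

Lemma nbhs_conj (g : G) (V : set G) : nbhs (1 : space t) V ->
  nbhs (1 : space t) [set z : G | V (g^-1 * z * g)].
Proof.
move=> V1; have /nbhs_mull : nbhs (g^-1 * 1 : space t) [set z : G | V (z * g)].
  by apply: nbhs_mulr; rewrite mulg1 mulVg.
exact.
Qed.

Lemma nbhs_inv (V : set G) : nbhs (1 : space t) V ->
  nbhs (1 : space t) [set z : G | V z^-1].
Proof. by move=> V1; apply: (Gt.2 (1 : space t)); rewrite invg1. Qed.

Lemma nbhs_cube (V : set G) : nbhs (1 : space t) V ->
  exists2 W : set G, nbhs (1 : space t) W &
    forall a b c, W a -> W b -> W c -> V (a * b * c).
Proof.
move=> V1; have : nbhs (1 * 1 : space t) V by rewrite mulg1.
move=> /nbhs_split[U [W [U1 W1 UW]]].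
have : nbhs (1 * 1 : space t) U by rewrite mulg1.
move=> /nbhs_split[X [Y [X1 Y1 XY]]].
exists (X `&` Y `&` W); first by apply: filterI => //; apply: filterI.
by move=> a b c [[Xa _] _] [[_ Yb] _] [_ Wc]; apply: UW => //; apply: XY.
Qed.

End TopologicalGroup.

(** * The sets [SP (An u j)] as neighbourhoods of the unit *)

Section SequenceFamily.
Context {G : groupType} {I : Type} (u : I -> nat -> G).
Implicit Types j : nat -> I -> G -> nat.

Lemma An1 j k : inhabited I -> An u j k 1.
Proof.
move=> [i]; exists i => //; exists 1 => //; exists 1; first by left.
by rewrite !mulg1 invg1.
Qed.

Lemma AnV j k x : An u j k x -> An u j k x^-1.
Proof.
move=> [i _ [g _ [y Ay <-]]]; exists i => //; exists g => //; exists y^-1.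
  case: Ay => [->|[n jn un]]; first by left; rewrite invg1.
  by right; exists n => //; case: un => ->; [right|left; rewrite invgK].
by rewrite !invgM invgK mulgA.
Qed.

(** Conjugating by [h] turns the conjugator [g] into [g * h]; the new index function undoes this
    shift. *)
Lemma AnJ j k h x : An u j k x -> An u (fun k i g => j k i (g * h^-1)) k (x ^ h).
Proof.
move=> [i _ [g _ [y Ay <-]]]; exists i => //; exists (g * h) => //; exists y.
  by rewrite mulgK.
by rewrite /conjg invgM !mulgA.
Qed.

Lemma An_sub j j' k k' : (forall i g, j' k' i g <= j k i g)%N ->
  An u j k `<=` An u j' k'.
Proof.
move=> le_j x [i _ [g _ [y Ay <-]]]; exists i => //; exists g => //; exists y => //.
case: Ay => [->|[n jn un]]; [by left|right]; exists n => //.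
exact: leq_trans (le_j i g) jn.
Qed.

Lemma SP_unit_base : inhabited I -> unit_base [set SP (An u j) | j in @J G I].
Proof.
move=> i0; have A1 j k := An1 j k i0.
split.
- by exists (SP (An u (fun k _ _ => k))); exists (fun k _ _ => k) => // k i g /=.
- by move=> _ [j Jj <-]; apply: SP_one.
- move=> _ _ [j Jj <-] [j' Jj' <-].
  pose m k i g := maxn (j k i g) (j' k i g).
  exists (SP (An u m)); first exists m => // k i g.
    by rewrite /m gtn_max !leq_max (Jj k i g) (Jj' k i g) orbT.
  move=> x mx; split; apply: SP_sub mx => k; apply: An_sub => i g.
    exact: leq_maxl.
  exact: leq_maxr.
- move=> _ x [j Jj <-] /(SP_open x (A1 j))[m jm].
  by exists (SP (fun k => An u j (m + k)%N)) => //;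
     exists (fun k => j (m + k)%N) => // k i g; rewrite addnS.
(* The odd index dominates the even one, so [An u j' k] lies in both [An u j k.*2] and
   [An u j k.*2.+1]. *)
- move=> _ [j Jj <-]; pose j' k := j k.*2.+1.
  have j'A k : An u j' k `<=` An u j k.*2.+1 by apply: An_sub.
  exists (SP (An u j')).
    exists j' => // k i g; rewrite /j' doubleS.
    exact: ltn_trans (Jj _ i g) (Jj _ i g).
  move=> x y; apply: SP_mul => // k; apply: An_sub => i g.
  exact: ltnW (Jj _ i g).
- move=> _ [j Jj <-]; exists (SP (An u j)); first by exists j.
  by move=> x; apply: SP_inv => // k; apply: AnV.
- move=> _ h [j Jj <-]; pose j' k i g := j k i (g * h).
  exists (SP (An u j')); first by exists j' => // k i g; apply: Jj.
  move=> x; apply: SP_conj => // k a /(AnJ _ _ h).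
  by apply: An_sub => i g; rewrite /j' mulgKV.
Qed.

Lemma cvg_nbhs_translates (t : Topological G) i :
  nbhs_translates [set SP (An u j) | j in @J G I] t -> cvg_to_unit t (u i).
Proof.
have A1 j k := An1 j k (inhabits i).
(* From [j 0 i 1] on, the terms are trivial conjugates in [An u j 0]. *)
move=> ntE V /ntE[_ [j Jj <-] jV]; exists (j 0 i 1) => // n jn /=.
rewrite -[u i n]mul1g; apply: jV; apply: (SP_incl 0) => //.
exists i => //; exists 1 => //; exists (u i n); first by right; exists n => //; left.
by rewrite invg1 mul1g mulg1.
Qed.

Lemma SP_sub_nbhs (t : Topological G) (V : set G) : inhabited I ->
    group_topology t -> (forall i, cvg_to_unit t (u i)) -> nbhs (1 : space t) V ->
  exists2 j, J j & SP (An u j) `<=` V.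
Proof.
move=> i0 Gt ut V1.
(* The hypothesis on [U] sits inside the existential so that [h] is total; for other sets [U] the
   value is arbitrary. *)
have /choice[h hP] (U : set G) : exists W : set G, nbhs (1 : space t) U ->
    nbhs (1 : space t) W /\ forall a b c, W a -> W b -> W c -> U (a * b * c).
  have [/(nbhs_cube Gt)[W W1 WU]|U1] := pselect (nbhs (1 : space t) U).
    by exists W.
  by exists U.
pose W n := iter n h V.
have W1 n : nbhs (1 : space t) (W n) by elim: n => //= n /hP[].
have Wu n : W n 1 by apply: (nbhs_singleton (W1 n)).
have /choice[N NP] (p : nat * I * G) : exists N, forall n, (N <= n)%N ->
    W p.1.1.+1 (p.2^-1 * u p.1.2 n * p.2) /\
    W p.1.1.+1 (p.2^-1 * (u p.1.2 n)^-1 * p.2).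
  case: p => [[k i] g] /=; have Wg := nbhs_conj Gt g _ (W1 k.+1).
  have [N _ NP] := ut i _ (filterI Wg (nbhs_inv Gt _ Wg)).
  by exists N => n /NP.
(* Each term is positive, so the sum grows strictly with [k]; its last term keeps it above
   [N (k, i, g)]. *)
pose j k i g := (\sum_(l < k.+1) (N (l : nat, i, g)).+1)%N.
exists j; first by move=> k i g; rewrite /j [ltnRHS]big_ord_recr /= -addSnnS leq_addr.
have jW k : An u j k `<=` W k.+1.
  move=> _ [i _ [g _ [y Ay <-]]]; case: Ay => [->|[n jn un]].
    by rewrite mulg1 mulVg.
  have /(NP (k, i, g))[] : (N (k, i, g) <= n)%N.
    by apply: leq_trans jn; rewrite /j big_ord_recr /= addnS ltnW // ltnS leq_addl.
  by case: un => ->.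
have A1 k := An1 j k i0.
rewrite SP_prods // => x [r /= Ur rx].
have WM n := (hP _ (W1 n)).2.
(* The interval starts at 0 because [W 0] is [V]. *)
apply: (prods_nested Wu WM r (\max_(k <- r) k).+1 0 Ur).
  by move=> k kr; rewrite add0n leq0n /= ltnS (big_rem _ kr) /= leq_maxl.
exact: prods_sub rx.
Qed.

End SequenceFamily.

(** * The equivalence and the finest topology *)

Lemma bigcap_SP_admissible (G : groupType) (I : Type) (u : I -> nat -> G) :
    inhabited I -> Ts_set (range u) ->
  \bigcap_(j in @J G I) SP (An u j) = [set (1 : G)].
Proof.
move=> i0 [t [Gt Ht ut]]; have {}ut i : cvg_to_unit t (u i) by apply: ut; exists i.
apply/seteqP; split=> [x jx|_ -> j Jj]; last first.
  by apply: SP_one => k; apply: An1.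
(* Every neighbourhood of 1 contains [x], so [x] itself witnesses that the two points cannot be
   separated. *)
apply/esym/(Ht (1 : space t) (x : space t)) => V W V1 Wx; exists x; split.
  by have [j Jj] := SP_sub_nbhs u t V i0 Gt ut V1; apply; apply: jx.
exact: (nbhs_singleton Wx).
Qed.

Lemma is_tau_SP (G : groupType) (I : Type) (u : I -> nat -> G) :
    inhabited I -> \bigcap_(j in @J G I) SP (An u j) = [set (1 : G)] ->
  exists t : Topological G, is_tau (range u) t /\
    open_base_at_unit t [set SP (An u j) | j in @J G I].
Proof.
move=> i0 cap1; have hB := SP_unit_base u i0.
have [t ntE] := unit_base_nbhs _ hB.
exists t; split; last exact: open_base_unit_base.
split.
  split; first exact: group_topology_unit_base ntE.
    by apply: hausdorff_unit_base ntE _ => //; rewrite bigcap_image.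
  by move=> _ [i _ <-]; apply: cvg_nbhs_translates.
(* For [O] open in [t'], translating to the unit finds a [SP (An u j)] whose translate by [x] stays
   in [O]. *)
move=> t' [Gt' _ ut'] O; rewrite !openE => oO x /oO xO; apply/ntE.
have {}ut' i : cvg_to_unit t' (u i) by apply: ut'; exists i.
have : nbhs ((x : G) * 1 : space t') O by rewrite mulg1.
move=> /(nbhs_mull Gt')/(SP_sub_nbhs u t' _ i0 Gt' ut')[j Jj jO].
by exists (SP (An u j)); [exists j|].
Qed.

Theorem theorem2p2 (G : groupType) (I : Type) (u : I -> nat -> G) :
  inhabited I ->
  (Ts_set (range u) <->
     \bigcap_(j in @J G I) SP (An u j) = [set (1 : G)]) /\
  (Ts_set (range u) ->
     exists t : Topological G, is_tau (range u) t /\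
       open_base_at_unit t [set SP (An u j) | j in @J G I]).
Proof.
move=> i0; split; last by move=> /(bigcap_SP_admissible _ _ u i0)/is_tau_SP; apply.
split; first exact: bigcap_SP_admissible.
by move=> /(is_tau_SP _ _ u i0)[t [[admt _] _]]; exists t.
Qed.
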